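(* If $F$ is a random continuous function, then $\lambda(\mathrm{ran}(F))>0$.
   Context: $\lambda$ is the uniform (Lebesgue) measure on $2^\omega$. Martin-Löf randomness of $x\in3^\omega$ is with respect to the uniform measure $\lambda_3$: $x$ is Martin-Löf random if $x\notin\bigcap_iU_i$ for every uniformly $\Sigma^0_1$ sequence $(U_i)$ of open subsets of $3^\omega$ with $\lambda_3(U_i)\le2^{-i}$. Let $\sigma_0=\epsilon,\sigma_1=0,\sigma_2=1,\dots$ be the length-lexicographic enumeration of $2^{<\omega}$. For $x\in3^\omega$ label node $\sigma_i$ ($i\ge1$) by $\ell_x(\sigma_i)=x(i-1)$, and let $F_x(y)$ be the sequence obtained from $\ell_x(y\restriction1),\ell_x(y\restriction2),\dots$ by deleting all $2$'s (undefined if only finitely many entries remain). $F$ is a random continuous function if $F=F_x$ for some Martin-Löf random $x\in3^\omega$. $\mathrm{ran}(F)$ denotes the range of $F$. *)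

(* Defs.v *)
From Stdlib Require Import Arith List.
Import ListNotations.

Inductive prf : Type :=
| Zero : prf
| Succ : prf
| Proj : nat -> prf
| Comp : prf -> list prf -> prf
| Rec  : prf -> prf -> prf
| Mu   : prf -> prf.

Inductive eval : prf -> list nat -> nat -> Prop :=
| e_zero v : eval Zero v 0
| e_succ n v : eval Succ (n :: v) (S n)
| e_proj i v : i < length v -> eval (Proj i) v (nth i v 0)
| e_comp f gs v ys r : evals gs v ys -> eval f ys r -> eval (Comp f gs) v r
| e_rec0 f g v r : eval f v r -> eval (Rec f g) (0 :: v) r
| e_recS f g n v y r :
    eval (Rec f g) (n :: v) y -> eval g (n :: y :: v) r ->
    eval (Rec f g) (S n :: v) r
| e_mu f v n :
    eval f (n :: v) 0 ->
    (forall m, m < n -> exists k, eval f (m :: v) (S k)) ->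
    eval (Mu f) v n
with evals : list prf -> list nat -> list nat -> Prop :=
| es_nil v : evals nil v nil
| es_cons g gs v y ys : eval g v y -> evals gs v ys -> evals (g :: gs) v (y :: ys).

Definition sigma01 (W : nat -> Prop) : Prop :=
  exists p : prf, forall n, W n <-> exists r, eval p [n] r.

Inductive trit : Type := T0 | T1 | T2.

Definition trit_nat (t : trit) : nat :=
  match t with T0 => 0 | T1 => 1 | T2 => 2 end.

(* bijective base-3 coding of 3^{<omega} into nat *)
Fixpoint code3 (s : list trit) : nat :=
  match s with
  | [] => 0
  | t :: s' => 1 + trit_nat t + 3 * code3 s'
  end.

Definition pair (i j : nat) : nat := (i + j) * (i + j + 1) / 2 + j.

Definition prefix_of {A : Type} (s : list A) (x : nat -> A) : Prop :=
  forall k, k < length s -> nth_error s k = Some (x k).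

Definition is_prefix {A : Type} (s t : list A) : Prop :=
  exists u, t = s ++ u.

(* Open set [W] = union of the cylinders [sigma], sigma in W.
   Its uniform measure lambda([W]) is sup_n |{tau in A^n : [tau] <= [W]
   via a prefix in W}| / |A|^n; the following predicates express
   comparisons of this measure with dyadic numbers. *)

Definition level_cover {A : Type} (W : list A -> Prop) (n : nat)
  (L : list (list A)) : Prop :=
  NoDup L /\ forall t, In t L -> length t = n /\ exists s, W s /\ is_prefix s t.

Definition lam3_open_le (W : list trit -> Prop) (i : nat) : Prop :=
  forall n L, level_cover W n L -> length L * 2 ^ i <= 3 ^ n.

Definition lam_open_gt (W : list bool -> Prop) (k : nat) : Prop :=
  exists n L, level_cover W n L /\ 2 ^ n < length L * 2 ^ k.

(* (Outer) Lebesgue measure of A <= 2^omega is positive: there is k such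
   that every open cover of A has measure > 2^{-k}. *)
Definition lam_pos (A : (nat -> bool) -> Prop) : Prop :=
  exists k, forall W : list bool -> Prop,
    (forall z, A z -> exists s, W s /\ prefix_of s z) ->
    lam_open_gt W k.

Definition unif_sigma01 (S : nat -> list trit -> Prop) : Prop :=
  sigma01 (fun m => exists i s, m = pair i (code3 s) /\ S i s).

Definition ML_random3 (x : nat -> trit) : Prop :=
  forall S : nat -> list trit -> Prop,
    unif_sigma01 S ->
    (forall i, lam3_open_le (S i) i) ->
    ~ (forall i, exists s, S i s /\ prefix_of s x).

(* idx y n = i such that sigma_i = y|n in the length-lexicographic
   enumeration sigma_0 = eps, sigma_1 = 0, sigma_2 = 1, sigma_3 = 00, ...
   (i.e. i = 2^n - 1 + (y(0)...y(n-1) read in binary)). *)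
Fixpoint idx (y : nat -> bool) (n : nat) : nat :=
  match n with
  | 0 => 0
  | S m => 2 * idx y m + 1 + (if y m then 1 else 0)
  end.

(* entry m (m >= 0) of the label sequence l_x(y|1), l_x(y|2), ...;
   l_x(sigma_i) = x(i-1). *)
Definition lab (x : nat -> trit) (y : nat -> bool) (m : nat) : trit :=
  x (idx y (S m) - 1).

Definition is2 (t : trit) : bool := match t with T2 => true | _ => false end.

Fixpoint count_non2 (x : nat -> trit) (y : nat -> bool) (n : nat) : nat :=
  match n with
  | 0 => 0
  | S m => count_non2 x y m + (if is2 (lab x y m) then 0 else 1)
  end.

Definition bit_trit (b : bool) : trit := if b then T1 else T0.

(* F_x(y) = z : z is the sequence of labels with the 2's deleted
   (in particular F_x(y) is defined, i.e. infinitely many non-2 labels). *)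
Definition F_graph (x : nat -> trit) (y z : nat -> bool) : Prop :=
  forall k, exists n, count_non2 x y n = k /\ lab x y n = bit_trit (z k).

Definition ran_F (x : nat -> trit) : (nat -> bool) -> Prop :=
  fun z => exists y, F_graph x y z.

(* Main.v *)
(* In the labelled binary tree, restrict attention to paths that never carry the label 2 at
   depths congruent to 2 modulo 3 below their starting node: such paths have infinite output.
   For fixed z, the nodes on such paths whose output is compatible with z form a branching
   process with mean (4/3)(4/3)(2/3) > 1 offspring per three levels, so z is produced below a
   given node with probability at least 1/10.  Hence with probability at least 1/20 the outputs
   produced below that node have measure at least 1/20.  The subtrees at the nodes 0^m 1 are
   independent, so "the first 14 i of them all produce measure below 1/20" has probability at
   most (19/20)^(14 i) <= 2^-i: this is a Martin-Loef test.  A random x therefore has a node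
   0^m 1 producing measure at least 1/20 at every finite depth, and compactness turns this
   into a lower bound on the measure of any open cover of the range. *)

From Stdlib Require Import Arith List Lia Bool Reals Lra.
From Stdlib Require Import Classical ClassicalEpsilon FunctionalExtensionality.
Require Import Defs.
Import ListNotations.

(** * Computability *)

(** Nested inductions handle the argument list of [Comp] and the counter of [Rec]. For [Mu], the
    smaller of two distinct results would make the body evaluate both to 0 and to a successor. *)
Lemma eval_det : forall p v r r', eval p v r -> eval p v r' -> r = r'.
Proof.
  fix IH 1. intros [| | i | f gs | f g | f] v r r' H H'.
  - inversion H; inversion H'; congruence.
  - inversion H; inversion H'; congruence.
  - inversion H; inversion H'; congruence.
  - assert (IHs : forall ys ys', evals gs v ys -> evals gs v ys' -> ys = ys').
    { clear H H'. induction gs as [|g gs IHgs]; intros ys ys' H H';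
        inversion H; inversion H'; subst; auto.
      f_equal; [eapply (IH g) | eapply IHgs]; eauto. }
    inversion H; inversion H'; subst.
    match goal with H1 : evals gs v ?a, H2 : evals gs v ?b |- _ =>
      rewrite (IHs a b H1 H2) in * end.
    eapply (IH f); eauto.
  - destruct v as [|n v]; [inversion H|].
    revert r r' H H'. induction n as [|n IHn]; intros r r' H H';
      inversion H; inversion H'; subst.
    + eapply (IH f); eauto.
    + match goal with H1 : eval (Rec f g) (n :: v) ?a, H2 : eval (Rec f g) (n :: v) ?b |- _ =>
        rewrite (IHn a b H1 H2) in * end.
      eapply (IH g); eauto.
  - inversion H as [| | | | | |f0 v0 n0 Z L]; inversion H' as [| | | | | |f1 v1 n1 Z' L']; subst.
    destruct (Nat.lt_trichotomy r r') as [K | [E | K]]; auto.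
    + destruct (L' _ K) as [k Hk]. discriminate (IH f _ _ _ Z Hk).
    + destruct (L _ K) as [k Hk]. discriminate (IH f _ _ _ Z' Hk).
Qed.

(* Contexts of [k] natural-number variables, innermost variable last.  Binders are
   uncurried into pairs so that the closure lemmas below apply by pattern unification
   to ordinary Gallina terms. *)
Fixpoint car (k : nat) : Type :=
  match k with 0 => unit | S k => (car k * nat)%type end.

Fixpoint enc (k : nat) : car k -> list nat :=
  match k with 0 => fun _ => [] | S k => fun e => snd e :: enc k (fst e) end.

Definition PR (k : nat) (f : car k -> nat) : Prop :=
  exists p, forall e, eval p (enc k e) (f e).

Definition PRb (k : nat) (f : car k -> bool) : Prop :=
  PR k (fun e => Nat.b2n (f e)).

Lemma length_enc k e : length (enc k e) = k.
Proof. induction k; simpl; auto. Qed.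

Lemma PR_ext k f g : (forall e, f e = g e) -> PR k f -> PR k g.
Proof. intros H [p Hp]; exists p; intros e; rewrite <- H; auto. Qed.

Lemma PR_var k i f : (forall e, nth_error (enc k e) i = Some (f e)) -> PR k f.
Proof.
  intros H. exists (Proj i). intros e.
  rewrite <- (nth_error_nth _ _ 0 (H e)). constructor.
  apply nth_error_Some. rewrite H. discriminate.
Qed.

Lemma PR_const k c : PR k (fun _ => c).
Proof.
  induction c as [|c [p Hp]].
  - exists Zero. constructor.
  - exists (Comp Succ [p]). intros e. econstructor.
    + constructor; [apply Hp | constructor].
    + constructor.
Qed.

Lemma PR_S k f : PR k f -> PR k (fun e => S (f e)).
Proof.
  intros [p Hp]. exists (Comp Succ [p]). intros e. econstructor.
  - constructor; [apply Hp | constructor].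
  - constructor.
Qed.

Lemma evals_proj_gen v i : i <= length v ->
  evals (map Proj (seq i (length v - i))) v (skipn i v).
Proof.
  intros Hi. remember (length v - i) as d eqn:Hd. revert i Hi Hd.
  induction d as [|d IH]; intros i Hi Hd.
  - rewrite skipn_all2 by lia. constructor.
  - simpl. assert (E : skipn i v = nth i v 0 :: skipn (S i) v).
    { assert (L : i < length v) by lia. clear - L. revert v L.
      induction i; intros [|a v] L; simpl in *; try lia; auto.
      rewrite IHi by lia. reflexivity. }
    rewrite E. constructor.
    + constructor. lia.
    + apply IH; lia.
Qed.

Lemma evals_proj v : evals (map Proj (seq 0 (length v))) v v.
Proof.
  generalize (evals_proj_gen v 0 (Nat.le_0_l _)).
  now rewrite Nat.sub_0_r.
Qed.

(** The step function lives in the context extended first by the previous value and then by the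
    counter, so that [enc] lists them in the order [n :: y :: v] of [e_recS]. *)
Lemma PR_rec k b g h : PR k b -> PR k g ->
  PR (S (S k)) (fun e => h (fst (fst e)) (snd e) (snd (fst e))) ->
  PR k (fun e => nat_rect (fun _ => nat) (b e) (fun j r => h e j r) (g e)).
Proof.
  intros [pb Hb] [pg Hg] [ph Hh].
  exists (Comp (Rec pb ph) (pg :: map Proj (seq 0 k))). intros e.
  econstructor.
  - constructor; [apply Hg|].
    rewrite <- (length_enc k e) at 1. apply evals_proj.
  - generalize (g e) as n. induction n as [|n IH]; simpl.
    + constructor. apply Hb.
    + econstructor; [apply IH|]. apply (Hh ((e, _), n)).
Qed.

Lemma PR_weak k f : PR k f -> PR (S k) (fun e => f (fst e)).
Proof.
  intros [p Hp]. exists (Comp p (map Proj (seq 1 k))). intros [e j]. econstructor.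
  - pose proof (evals_proj_gen (j :: enc k e) 1) as H.
    simpl length in H. rewrite length_enc in H.
    replace (S k - 1) with k in H by lia. apply H. lia.
  - apply Hp.
Qed.

Lemma PR_comp1 k f g : PR 1 (fun e => f (snd e)) -> PR k g -> PR k (fun e => f (g e)).
Proof.
  intros [p Hp] [q Hq]. exists (Comp p [q]). intros e. econstructor.
  - constructor; [apply Hq | constructor].
  - apply (Hp (tt, g e)).
Qed.

Lemma PR_comp2 k f g h : PR 2 (fun e => f (snd (fst e)) (snd e)) -> PR k g -> PR k h ->
  PR k (fun e => f (g e) (h e)).
Proof.
  intros [p Hp] [q Hq] [r Hr]. exists (Comp p [r; q]). intros e. econstructor.
  - constructor; [apply Hr | constructor; [apply Hq | constructor]].
  - apply (Hp ((tt, g e), h e)).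
Qed.

Ltac pr_var :=
  first [ apply (PR_var _ 0); reflexivity | apply (PR_var _ 1); reflexivity
        | apply (PR_var _ 2); reflexivity | apply (PR_var _ 3); reflexivity
        | apply (PR_var _ 4); reflexivity | apply (PR_var _ 5); reflexivity
        | apply (PR_var _ 6); reflexivity | apply (PR_var _ 7); reflexivity ].

(** * Primitive recursive arithmetic and Boolean operations *)

Lemma PR_add k f g : PR k f -> PR k g -> PR k (fun e => f e + g e).
Proof.
  apply PR_comp2.
  eapply PR_ext; [| apply (PR_rec 2 (fun e => snd e) (fun e => snd (fst e))
                             (fun e j r => S r))].
  - intros [[[] a] b]; simpl. induction a; simpl; auto.
  - pr_var.
  - pr_var.
  - apply PR_S. pr_var.
Qed.

Lemma PR_mul k f g : PR k f -> PR k g -> PR k (fun e => f e * g e).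
Proof.
  apply PR_comp2.
  eapply PR_ext; [| apply (PR_rec 2 (fun e => 0) (fun e => snd (fst e))
                             (fun e j r => snd e + r))].
  - intros [[[] a] b]; simpl. induction a; simpl; auto.
  - apply PR_const.
  - pr_var.
  - apply PR_add; pr_var.
Qed.

Lemma PR_pred k f : PR k f -> PR k (fun e => pred (f e)).
Proof.
  apply PR_comp1.
  eapply PR_ext; [| apply (PR_rec 1 (fun e => 0) (fun e => snd e)
                             (fun e j r => j))].
  - intros [[] a]; destruct a; reflexivity.
  - apply PR_const.
  - pr_var.
  - pr_var.
Qed.

Lemma PR_sub k f g : PR k f -> PR k g -> PR k (fun e => f e - g e).
Proof.
  apply PR_comp2.
  eapply PR_ext; [| apply (PR_rec 2 (fun e => snd (fst e)) (fun e => snd e)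
                             (fun e j r => pred r))].
  - intros [[[] a] b]; simpl. induction b; simpl; lia.
  - pr_var.
  - pr_var.
  - apply PR_pred. pr_var.
Qed.

Lemma PR_pow k c f : PR k f -> PR k (fun e => c ^ f e).
Proof.
  apply (PR_comp1 k (fun a => c ^ a)).
  eapply PR_ext; [| apply (PR_rec 1 (fun e => 1) (fun e => snd e)
                             (fun e j r => c * r))].
  - intros [[] a]; simpl. induction a; simpl; lia.
  - apply PR_const.
  - pr_var.
  - apply PR_mul; [apply PR_const | pr_var].
Qed.

Lemma PRb_leb k f g : PR k f -> PR k g -> PRb k (fun e => f e <=? g e).
Proof.
  intros Hf Hg. eapply PR_ext; [| apply (PR_sub _ (fun _ => 1) _ (PR_const _ _) (PR_sub _ _ _ Hf Hg))].
  intros e. cbv beta. destruct (Nat.leb_spec (f e) (g e)); simpl Nat.b2n; lia.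
Qed.

Lemma PRb_ltb k f g : PR k f -> PR k g -> PRb k (fun e => f e <? g e).
Proof. intros; apply PRb_leb; auto; apply PR_S; auto. Qed.

Lemma PRb_andb k f g : PRb k f -> PRb k g -> PRb k (fun e => f e && g e).
Proof.
  intros Hf Hg. eapply PR_ext; [| apply (PR_mul _ _ _ Hf Hg)].
  intros e. cbv beta. destruct (f e), (g e); reflexivity.
Qed.

Lemma PRb_negb k f : PRb k f -> PRb k (fun e => negb (f e)).
Proof.
  intros Hf. eapply PR_ext; [| apply (PR_sub _ (fun _ => 1) _ (PR_const _ _) Hf)].
  intros e. cbv beta. destruct (f e); reflexivity.
Qed.

Lemma PRb_eqb k f g : PR k f -> PR k g -> PRb k (fun e => f e =? g e).
Proof.
  intros Hf Hg. eapply PR_ext; [| apply (PRb_andb _ _ _ (PRb_leb _ _ _ Hf Hg) (PRb_leb _ _ _ Hg Hf))].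
  intros e. cbv beta. f_equal. destruct (Nat.leb_spec (f e) (g e)), (Nat.leb_spec (g e) (f e)),
    (Nat.eqb_spec (f e) (g e)); simpl; auto; lia.
Qed.

Lemma PR_if k c f g : PRb k c -> PR k f -> PR k g ->
  PR k (fun e => if c e then f e else g e).
Proof.
  intros Hc Hf Hg. eapply PR_ext;
    [| apply (PR_add _ _ _ (PR_mul _ _ _ Hc Hf) (PR_mul _ _ _ (PRb_negb _ _ Hc) Hg))].
  intros e. cbv beta. destruct (c e); simpl; lia.
Qed.

Lemma PRb_if k c f g : PRb k c -> PRb k f -> PRb k g ->
  PRb k (fun e => if c e then f e else g e).
Proof.
  intros Hc Hf Hg. eapply PR_ext; [| apply (PR_if _ _ _ _ Hc Hf Hg)].
  intros e. cbv beta. destruct (c e); reflexivity.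
Qed.

(** * Bounded counting, bounded quantifiers and division *)

Lemma PR_count k f g : PRb (S k) (fun e => f (fst e) (snd e)) -> PR k g ->
  PR k (fun e => length (filter (fun j => f e j) (seq 0 (g e)))).
Proof.
  intros [p Hp] Hg.
  eapply PR_ext; [| apply (PR_rec k (fun e => 0) g
                             (fun e j r => r + Nat.b2n (f e j)))]; auto.
  - intros e. cbv beta. generalize (g e) as n. induction n as [|n IH]; auto.
    rewrite seq_S, filter_app, length_app. simpl. rewrite IH.
    destruct (f e n); reflexivity.
  - apply PR_const.
  - apply PR_add; [pr_var|].
    (* The projections skip variable 1, the running total, which [f] does not take. *)
    exists (Comp p (Proj 0 :: map Proj (seq 2 k))). intros [[e r] j]. econstructor.
    + constructor.
      * constructor. simpl. lia.
      * simpl. pose proof (evals_proj_gen (j :: r :: enc k e) 2) as H.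
        simpl length in H. rewrite length_enc in H.
        replace (S (S k) - 2) with k in H by lia. apply H. lia.
    + apply (Hp (e, j)).
Qed.

Lemma length_filter_pos {A} (f : A -> bool) l :
  (0 <? length (filter f l)) = existsb f l.
Proof. induction l as [|a l IH]; simpl; auto. destruct (f a); simpl; auto. Qed.

Lemma PRb_existsb k f g : PRb (S k) (fun e => f (fst e) (snd e)) -> PR k g ->
  PRb k (fun e => existsb (fun j => f e j) (seq 0 (g e))).
Proof.
  intros Hf Hg. eapply PR_ext;
    [| apply (PRb_ltb _ (fun _ => 0) _ (PR_const _ _) (PR_count _ _ _ Hf Hg))].
  intros e. cbv beta. f_equal. apply length_filter_pos.
Qed.

Lemma PRb_forallb k f g : PRb (S k) (fun e => f (fst e) (snd e)) -> PR k g ->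
  PRb k (fun e => forallb (fun j => f e j) (seq 0 (g e))).
Proof.
  intros Hf Hg. eapply PR_ext;
    [| apply (PRb_negb _ _ (PRb_existsb _ (fun e j => negb (f e j)) _ (PRb_negb _ _ Hf) Hg))].
  intros e. cbv beta. f_equal. generalize (seq 0 (g e)) as l.
  induction l as [|a l IH]; simpl; auto. destruct (f e a); simpl; auto.
Qed.

Lemma count_lt m n : length (filter (fun j => j <? m) (seq 0 n)) = Nat.min m n.
Proof.
  induction n as [|n IH]; [rewrite Nat.min_0_r; auto|].
  rewrite seq_S, filter_app, length_app, IH. simpl.
  destruct (Nat.ltb_spec n m); simpl; lia.
Qed.

(** The quotient of [a] by [c] is the number of [j] with [S j * c <= a]; all of these lie below [a]
    because [c] is positive. *)
Lemma PR_div k c f : PR k f -> PR k c -> (forall e, c e <> 0) -> PR k (fun e => f e / c e).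
Proof.
  intros Hf Hc Hc0.
  assert (H : PR 2 (fun e => (fun a c => length (filter (fun j => S j * c <=? a) (seq 0 a)))
                         (snd (fst e)) (snd e))).
  { apply PR_count; [| pr_var].
    apply PRb_leb; [| pr_var]. apply PR_mul; [apply PR_S |]; pr_var. }
  eapply PR_ext; [| apply (PR_comp2 _ _ _ _ H Hf Hc)].
  intros e. cbv beta. specialize (Hc0 e). generalize dependent (c e). intros d Hd.
  generalize (f e) as a. intros a.
  rewrite (filter_ext _ (fun j => j <? a / d)).
  - rewrite count_lt. apply Nat.min_l. apply Nat.Div0.div_le_upper_bound; nia.
  - intros j. simpl. apply eq_true_iff_eq. rewrite Nat.leb_le, Nat.ltb_lt. split; intros H1.
    + apply Nat.div_le_lower_bound; [auto | lia].
    + pose proof (Nat.Div0.mul_div_le a d). nia.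
Qed.

Lemma PR_mod k c f : PR k f -> PR k c -> (forall e, c e <> 0) -> PR k (fun e => f e mod c e).
Proof.
  intros Hf Hc Hc0.
  eapply PR_ext;
    [| apply (PR_sub _ _ _ Hf (PR_mul _ _ _ Hc (PR_div _ _ _ Hf Hc Hc0)))].
  intros e. cbv beta. pose proof (Nat.div_mod_eq (f e) (c e)). lia.
Qed.

Lemma PRb_testbit k f g : PR k f -> PR k g -> PRb k (fun e => Nat.testbit (f e) (g e)).
Proof.
  intros Hf Hg.
  eapply PR_ext; [| apply (PR_mod _ (fun _ => 2) (fun e => f e / 2 ^ g e))].
  - intros e. cbv beta. symmetry. apply Nat.testbit_spec'.
  - apply PR_div; auto.
    + apply PR_pow; auto.
    + intros e. apply Nat.pow_nonzero. lia.
  - apply PR_const.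
  - lia.
Qed.

(** * The test and its decidability *)

(* Nodes are numbered from 1 in heap order, so that the children of [b] are [2 b] and
   [2 b + 1]: sigma_i is node [i + 1], and the label of node [b >= 2] is [X (b - 2)].
   Labels are natural numbers, [T0], [T1], [T2] becoming 0, 1, 2. *)
Fixpoint node (b : nat) (y : nat -> bool) (n : nat) : nat :=
  match n with 0 => b | S m => 2 * node b y m + Nat.b2n (y m) end.

Definition label (X : nat -> nat) b y m : nat := X (node b y (S m) - 2).

Fixpoint outputs (X : nat -> nat) b y n : nat :=
  match n with
  | 0 => 0
  | S m => outputs X b y m + (if label X b y m =? 2 then 0 else 1)
  end.

(* The phase [ph] is the depth modulo 3; a label 2 is forbidden in phase 2. *)
Definition ok (X : nat -> nat) b ph (y z : nat -> bool) n : bool :=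
  forallb (fun m => if label X b y m =? 2 then negb ((ph + m) mod 3 =? 2)
                    else label X b y m =? Nat.b2n (z (outputs X b y m))) (seq 0 n).

(** Paths of length [n] are coded by the binary digits of numbers below [2 ^ n], so the quantifier
    over paths is bounded. *)
Definition surv X b ph n (z : nat -> bool) : bool :=
  existsb (fun Y => ok X b ph (Nat.testbit Y) z n) (seq 0 (2 ^ n)).

Definition surv_count X b n : nat :=
  length (filter (fun Z => surv X b 0 n (Nat.testbit Z)) (seq 0 (2 ^ n))).

Definition sparse X b n : bool := 20 * surv_count X b n <? 2 ^ n.

(* For [b = 1] these are the nodes 0^m 1. *)
Definition all_sparse X b n q : bool :=
  forallb (fun m => sparse X (b * 2 ^ S m + 1) n) (seq 0 q).

(** Drops the first [k] letters of the string coded by [c]. Truncated subtraction fixes 0, the code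
    of the empty string, so a letter read past the end is 0. *)
Fixpoint code3_tail (c k : nat) : nat :=
  match k with 0 => c | S k => (code3_tail c k - 1) / 3 end.

Definition code3_digit c k : nat := (code3_tail c k - 1) mod 3.

(** Decides [rtest] on codes. A nonzero tail says that the string is long enough, and this length
    already forces [n] below [c], so searching below [c] suffices. *)
Definition rtestb (i c : nat) : bool :=
  existsb (fun n => (0 <? code3_tail c (2 ^ (14 * i + n + 3))) && all_sparse (code3_digit c) 1 n (14 * i))
    (seq 0 c).

(** * Primitive recursiveness of the test *)

Ltac pr1 :=
  lazymatch goal with
  | |- PRb _ (fun e => _ <=? _) => apply PRb_leb
  | |- PRb _ (fun e => _ <? _) => apply PRb_ltb
  | |- PRb _ (fun e => _ =? _) => apply PRb_eqb
  | |- PRb _ (fun e => _ && _) => apply PRb_andb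
  | |- PRb _ (fun e => negb _) => apply PRb_negb
  | |- PRb _ (fun e => if _ then _ else _) => apply PRb_if
  | |- PRb _ (fun e => existsb _ (seq 0 _)) => apply PRb_existsb
  | |- PRb _ (fun e => forallb _ (seq 0 _)) => apply PRb_forallb
  | |- PRb _ (fun e => Nat.testbit _ _) => apply PRb_testbit
  | |- PR _ (fun e => length (filter _ (seq 0 _))) => apply PR_count
  | |- PR _ (fun e => if _ then _ else _) => apply PR_if
  | |- PR _ (fun e => Nat.b2n (@?f e)) => change (PRb _ f)
  | |- PR _ (fun e => _ / _) => apply PR_div; [| | lia]
  | |- PR _ (fun e => _ mod _) => apply PR_mod; [| | lia]
  | |- PR _ (fun e => S _) => apply PR_S
  end.
Ltac pr :=
  cbv beta;
  first [ assumption | solve [pr_var]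
        | lazymatch goal with |- PR _ (fun _ => ?c) => apply PR_const end
        | lazymatch goal with
          | |- PR (S ?k) (fun e => ?f (fst e)) => apply (PR_weak k f)
          | |- PR (S (S ?k)) (fun e => ?f (fst (fst e))) => apply (PR_weak (S k) (fun e => f (fst e)))
          | |- PR (S (S (S ?k))) (fun e => ?f (fst (fst (fst e)))) =>
              apply (PR_weak (S (S k)) (fun e => f (fst (fst e))))
          end; pr
        | pr1; pr
        | lazymatch goal with
          | |- PR _ (fun e => _ + _) => apply PR_add
          | |- PR _ (fun e => _ * _) => apply PR_mul
          | |- PR _ (fun e => _ - _) => apply PR_sub
          | |- PR _ (fun e => _ ^ _) => apply PR_pow
          end; pr
        | idtac ].

Ltac by_rec m :=
  let e := fresh in let n := fresh in
  intros e; cbv beta; generalize (m e) as n;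
  intros n; induction n as [|n IH]; [reflexivity | cbn [nat_rect node outputs code3_tail]; rewrite <- IH; reflexivity].

Lemma PR_node k b Y m : PR k b -> PR k Y -> PR k m ->
  PR k (fun e => node (b e) (Nat.testbit (Y e)) (m e)).
Proof.
  intros Hb HY Hm.
  eapply PR_ext; [| apply (PR_rec k b m (fun e j r => 2 * r + Nat.b2n (Nat.testbit (Y e) j)))]; [by_rec m | pr..].
Qed.

Lemma PR_code3_tail k c m : PR k c -> PR k m -> PR k (fun e => code3_tail (c e) (m e)).
Proof.
  intros Hc Hm.
  eapply PR_ext; [| apply (PR_rec k c m (fun e j r => (r - 1) / 3))]; [by_rec m | pr..].
Qed.

Lemma PR_label k c b Y m : PR k c -> PR k b -> PR k Y -> PR k m ->
  PR k (fun e => label (code3_digit (c e)) (b e) (Nat.testbit (Y e)) (m e)).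
Proof.
  intros Hc Hb HY Hm. unfold label, code3_digit. pr. apply PR_code3_tail; pr.
  apply PR_node; pr.
Qed.

Lemma PR_outputs k c b Y m : PR k c -> PR k b -> PR k Y -> PR k m ->
  PR k (fun e => outputs (code3_digit (c e)) (b e) (Nat.testbit (Y e)) (m e)).
Proof.
  intros Hc Hb HY Hm.
  eapply PR_ext; [| apply (PR_rec k (fun _ => 0) m
    (fun e j r => r + (if label (code3_digit (c e)) (b e) (Nat.testbit (Y e)) j =? 2 then 0 else 1)))]; [by_rec m | pr..].
  apply PR_label; pr.
Qed.

Lemma PRb_ok k c b ph Y Z n : PR k c -> PR k b -> PR k ph -> PR k Y -> PR k Z -> PR k n ->
  PRb k (fun e => ok (code3_digit (c e)) (b e) (ph e) (Nat.testbit (Y e)) (Nat.testbit (Z e)) (n e)).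
Proof.
  intros Hc Hb Hph HY HZ Hn. unfold ok. pr; try apply PR_label; pr. apply PR_outputs; pr.
Qed.

Lemma PRb_sparse k c b n : PR k c -> PR k b -> PR k n ->
  PRb k (fun e => sparse (code3_digit (c e)) (b e) (n e)).
Proof.
  intros Hc Hb Hn. unfold sparse, surv_count, surv. pr. apply PRb_ok; pr.
Qed.

Lemma PRb_rtestb k i c : PR k i -> PR k c -> PRb k (fun e => rtestb (i e) (c e)).
Proof.
  intros Hi Hc. unfold rtestb, all_sparse. pr.
  - apply PR_code3_tail; pr.
  - apply PRb_sparse; pr.
Qed.

(** Unpairs by bounded search: both components of a pair are at most its code. *)
Definition searchb (m : nat) : bool :=
  existsb (fun i => existsb (fun c => (m =? pair i c) && rtestb i c) (seq 0 (S m))) (seq 0 (S m)).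

Lemma PRb_searchb : PRb 1 (fun e => searchb (snd e)).
Proof.
  unfold searchb, pair. pr. apply PRb_rtestb; pr.
Qed.

Lemma le_pair i j : i <= pair i j /\ j <= pair i j.
Proof.
  unfold pair.
  assert (i + j <= (i + j) * (i + j + 1) / 2) by (apply Nat.div_le_lower_bound; nia).
  lia.
Qed.

(** Minimisation over a variable that [f] ignores halts at 0 when [f m] holds and diverges
    otherwise. *)
Lemma sigma01_of_PRb (f : nat -> bool) : PRb 1 (fun e => f (snd e)) ->
  sigma01 (fun m => f m = true).
Proof.
  intros Hf. assert (H : PRb 2 (fun e => negb (f (snd (fst e))))).
  { apply PRb_negb. apply (PR_weak 1 _ Hf). }
  destruct H as [p Hp]. exists (Mu p). intros m. split.
  - intros Hm. exists 0. constructor; [| lia].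
    specialize (Hp ((tt, m), 0)). simpl in Hp. now rewrite Hm in Hp.
  - intros [r Hr]. inversion Hr as [| | | | | |f0 v0 n0 Z L]; subst.
    specialize (Hp ((tt, m), r)). simpl in Hp.
    pose proof (eval_det _ _ _ _ Z Hp) as E. destruct (f m); auto; discriminate.
Qed.

(** * Decoding strings, and the test as a uniform family *)

Lemma code3_surj c : exists s, code3 s = c.
Proof.
  induction c as [c IH] using lt_wf_ind. destruct c as [|c]; [now exists []|].
  destruct (IH (c / 3)) as [s Hs].
  { pose proof (Nat.Div0.div_le_upper_bound c 3 c). lia. }
  pose proof (Nat.div_mod_eq c 3) as E. pose proof (Nat.mod_upper_bound c 3).
  destruct (c mod 3) as [|[|[|]]] eqn:Em; try lia;
    [exists (T0 :: s) | exists (T1 :: s) | exists (T2 :: s)]; simpl; lia.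
Qed.

Lemma code3_cons t s : code3 (t :: s) - 1 = trit_nat t + code3 s * 3.
Proof. simpl. lia. Qed.

Lemma code3_tail_code3 s k : code3_tail (code3 s) k = code3 (skipn k s).
Proof.
  induction k as [|k IH]; auto. cbn [code3_tail]. rewrite IH. clear IH.
  revert s; induction k as [|k IH]; intros [|t s]; auto.
  - change (skipn 0 (t :: s)) with (t :: s). rewrite code3_cons, Nat.div_add by lia.
    destruct t; reflexivity.
  - apply (IH s).
Qed.

Definition digits (s : list trit) (k : nat) : nat := trit_nat (nth k s T0).

Lemma code3_digit_code3 s k : code3_digit (code3 s) k = digits s k.
Proof.
  unfold code3_digit, digits. rewrite code3_tail_code3.
  revert s; induction k as [|k IH]; intros [|t s]; auto.
  - change (skipn 0 (t :: s)) with (t :: s). rewrite code3_cons, Nat.Div0.mod_add.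
    destruct t; reflexivity.
  - apply (IH s).
Qed.

Lemma code3_tail_code3_pos s k : (0 <? code3_tail (code3 s) k) = (k <? length s).
Proof.
  rewrite code3_tail_code3. revert s; induction k as [|k IH]; intros [|t s]; simpl; auto.
Qed.

Lemma length_le_code3 s : length s <= code3 s.
Proof. induction s; simpl; lia. Qed.

(* The length bound ensures that [all_sparse] only reads labels that [s] provides. *)
Definition rtest (i : nat) (s : list trit) : Prop :=
  exists n, 2 ^ (14 * i + n + 3) < length s /\ all_sparse (digits s) 1 n (14 * i) = true.

Lemma unif_sigma01_rtest : unif_sigma01 rtest.
Proof.
  unfold unif_sigma01.
  assert (Htest : forall i s, rtestb i (code3 s) = true <-> rtest i s).
  { intros i s. unfold rtestb, rtest.
    assert (Ed : code3_digit (code3 s) = digits s) by (extensionality k; apply code3_digit_code3).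
    rewrite Ed, existsb_exists. split.
    - intros [n [_ H]]. exists n. rewrite code3_tail_code3_pos, andb_true_iff, Nat.ltb_lt in H. auto.
    - intros [n [H1 H2]]. exists n. rewrite code3_tail_code3_pos, andb_true_iff, Nat.ltb_lt.
      split; auto. apply in_seq. pose proof (length_le_code3 s).
      pose proof (Nat.pow_gt_lin_r 2 (14 * i + n + 3) ltac:(lia)). lia. }
  destruct (sigma01_of_PRb searchb PRb_searchb) as [p Hp]. exists p. intros m.
  rewrite <- Hp. unfold searchb. rewrite existsb_exists. split.
  - intros [i [s [-> H]]]. exists i. pose proof (le_pair i (code3 s)).
    split; [apply in_seq; lia|]. apply existsb_exists. exists (code3 s).
    split; [apply in_seq; lia|]. rewrite Nat.eqb_refl. now apply Htest.
  - intros [i [_ H]]. apply existsb_exists in H. destruct H as [c [_ H]].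
    apply andb_true_iff in H. destruct H as [H1 H2]. apply Nat.eqb_eq in H1.
    destruct (code3_surj c) as [s <-]. exists i, s. split; auto. now apply Htest.
Qed.

(** * Survival in subtrees *)

Definition shift {A} (z : nat -> A) : nat -> A := fun k => z (S k).

Lemma forallb_pointwise {A} (f g : A -> bool) l :
  (forall a, f a = g a) -> forallb f l = forallb g l.
Proof. intros H. induction l; simpl; congruence. Qed.

Lemma forallb_seq_S f n :
  forallb f (seq 0 (S n)) = f 0 && forallb (fun m => f (S m)) (seq 0 n).
Proof.
  simpl. f_equal. rewrite <- seq_shift. generalize (seq 0 n) as l.
  induction l; simpl; congruence.
Qed.

(** [node] recurses on the last step of a path, whereas the branching argument splits off the first
    step and moves the root to a child. *)
Lemma node_S b y n : node b y (S n) = node (2 * b + Nat.b2n (y 0)) (shift y) n.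
Proof.
  induction n as [|n IH]; [reflexivity|].
  change (node b y (S (S n))) with (2 * node b y (S n) + Nat.b2n (y (S n))).
  rewrite IH. reflexivity.
Qed.

Lemma label_S X b y m : label X b y (S m) = label X (2 * b + Nat.b2n (y 0)) (shift y) m.
Proof. unfold label. now rewrite node_S. Qed.

Lemma outputs_S X b y n : outputs X b y (S n) =
  (if label X b y 0 =? 2 then 0 else 1) + outputs X (2 * b + Nat.b2n (y 0)) (shift y) n.
Proof.
  induction n as [|n IH]; [cbn [outputs]; lia|].
  change (outputs X b y (S (S n))) with (outputs X b y (S n) + (if label X b y (S n) =? 2 then 0 else 1)).
  rewrite IH, label_S. cbn [outputs]. lia.
Qed.

Lemma ok_S X b ph y z n : ok X b ph y z (S n) =
  (if label X b y 0 =? 2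
   then negb (ph mod 3 =? 2) && ok X (2 * b + Nat.b2n (y 0)) (S ph) (shift y) z n
   else (label X b y 0 =? Nat.b2n (z 0)) &&
        ok X (2 * b + Nat.b2n (y 0)) (S ph) (shift y) (shift z) n).
Proof.
  unfold ok. rewrite forallb_seq_S, Nat.add_0_r. change (outputs X b y 0) with 0.
  transitivity ((if label X b y 0 =? 2 then negb (ph mod 3 =? 2)
                 else label X b y 0 =? Nat.b2n (z 0)) &&
    forallb (fun m => if label X (2 * b + Nat.b2n (y 0)) (shift y) m =? 2
      then negb ((S ph + m) mod 3 =? 2)
      else label X (2 * b + Nat.b2n (y 0)) (shift y) m =?
           Nat.b2n (z ((if label X b y 0 =? 2 then 0 else 1)
                       + outputs X (2 * b + Nat.b2n (y 0)) (shift y) m))) (seq 0 n)).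
  - f_equal. apply forallb_pointwise. intros m. rewrite label_S, outputs_S.
    now replace (ph + S m) with (S ph + m) by lia.
  - destruct (label X b y 0 =? 2); reflexivity.
Qed.

Lemma node_ext b y y' n : (forall j, j < n -> y j = y' j) -> node b y n = node b y' n.
Proof.
  induction n as [|n IH]; intros H; auto. cbn [node].
  rewrite IH, (H n); auto.
Qed.

Lemma label_ext X b y y' m : (forall j, j <= m -> y j = y' j) -> label X b y m = label X b y' m.
Proof. intros H. unfold label. now rewrite (node_ext b y y') by (intros; apply H; lia). Qed.

Lemma outputs_ext X b y y' n : (forall j, j < n -> y j = y' j) -> outputs X b y n = outputs X b y' n.
Proof.
  induction n as [|n IH]; intros H; auto. cbn [outputs].
  rewrite IH, (label_ext X b y y'); auto. intros; apply H; lia.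
Qed.

Lemma outputs_le X b y n : outputs X b y n <= n.
Proof. induction n; cbn [outputs]; auto. destruct (_ =? _); lia. Qed.

Lemma forallb_seq_true f n : forallb f (seq 0 n) = true <-> forall m, m < n -> f m = true.
Proof.
  rewrite forallb_forall. split; intros H m Hm; apply H; rewrite in_seq in *; lia.
Qed.

Lemma ok_ext X b ph y y' z z' n :
  (forall j, j < n -> y j = y' j) -> (forall j, j < n -> z j = z' j) ->
  ok X b ph y z n = true -> ok X b ph y' z' n = true.
Proof.
  intros Hy Hz. unfold ok. rewrite !forallb_seq_true. intros H m Hm.
  specialize (H m Hm). rewrite (label_ext X b y y'), (outputs_ext X b y y') in H
    by (intros; apply Hy; lia).
  rewrite <- Hz; auto. pose proof (outputs_le X b y' m). lia.
Qed.

Lemma ok_le X b ph y z n n' : n <= n' -> ok X b ph y z n' = true -> ok X b ph y z n = true.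
Proof.
  intros Hn. unfold ok. rewrite !forallb_seq_true. intros H m Hm. apply H. lia.
Qed.

Lemma testbit_prefix n : forall y : nat -> bool,
  exists Y, Y < 2 ^ n /\ forall j, j < n -> Nat.testbit Y j = y j.
Proof.
  induction n as [|n IH]; intros y.
  - exists 0. split; [simpl; lia | intros; lia].
  - destruct (IH (shift y)) as [Y [HY H]]. exists (2 * Y + Nat.b2n (y 0)). split.
    + simpl. destruct (y 0); simpl; lia.
    + intros [|j] Hj.
      * apply Nat.testbit_0_r.
      * rewrite Nat.testbit_succ_r. apply H. lia.
Qed.

Lemma surv_iff X b ph n z : surv X b ph n z = true <-> exists y, ok X b ph y z n = true.
Proof.
  unfold surv. rewrite existsb_exists. split.
  - intros [Y [_ H]]. eauto.
  - intros [y H]. destruct (testbit_prefix n y) as [Y [HY HYy]]. exists Y.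
    split; [apply in_seq; lia|]. revert H. apply ok_ext; auto. intros; symmetry; auto.
Qed.

Lemma surv_ext X b ph n z z' : (forall j, j < n -> z j = z' j) ->
  surv X b ph n z = true -> surv X b ph n z' = true.
Proof. rewrite !surv_iff. intros H [y Hy]. exists y. revert Hy. now apply ok_ext. Qed.

Lemma surv_S_le X b ph n z : surv X b ph (S n) z = true -> surv X b ph n z = true.
Proof. rewrite !surv_iff. intros [y Hy]. exists y. revert Hy. apply ok_le. lia. Qed.

(** Survival through the child [b], whose own label is now read: a permitted 2 leaves [z] intact, a
    matching bit consumes its first entry. *)
Definition branch X b ph n (z : nat -> bool) : bool :=
  if X (b - 2) =? 2 then negb (ph mod 3 =? 2) && surv X b (S ph) n z
  else (X (b - 2) =? Nat.b2n (z 0)) && surv X b (S ph) n (shift z).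

Lemma branch_iff X b ph n z c : branch X (2 * b + Nat.b2n c) ph n z = true <->
  exists y, y 0 = c /\ ok X b ph y z (S n) = true.
Proof.
  unfold branch. split.
  - intros H.
    assert (H' : exists y, ok X b ph (fun k => match k with 0 => c | S k => y k end) z (S n) = true).
    { setoid_rewrite ok_S. unfold label. cbn [node].
      destruct (X _ =? 2); apply andb_true_iff in H; destruct H as [H1 H2];
        apply surv_iff in H2; destruct H2 as [y Hy]; exists y; now rewrite H1. }
    destruct H' as [y Hy]. eexists; split; [| exact Hy]. reflexivity.
  - intros [y [<- H]]. rewrite ok_S in H. unfold label in H. cbn [node] in H.
    destruct (X _ =? 2); apply andb_true_iff in H; destruct H as [H1 H2]; rewrite H1;
      apply surv_iff; eauto.
Qed.

Lemma surv_S X b ph n z :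
  surv X b ph (S n) z = branch X (2 * b) ph n z || branch X (2 * b + 1) ph n z.
Proof.
  apply eq_true_iff_eq. rewrite orb_true_iff, surv_iff.
  rewrite (branch_iff X b ph n z true).
  replace (2 * b) with (2 * b + Nat.b2n false) at 1 by (simpl; lia).
  rewrite branch_iff. split.
  - intros [y H]. destruct (y 0) eqn:E; eauto.
  - intros [[y [_ H]] | [y [_ H]]]; eauto.
Qed.

(** * Monotonicity of sparseness in the depth *)

Lemma filter_length_le {A} (f g : A -> bool) l :
  (forall a, f a = true -> g a = true) -> length (filter f l) <= length (filter g l).
Proof.
  intros H. induction l as [|a l IH]; simpl; auto.
  specialize (H a). destruct (f a), (g a); simpl; auto; lia.
Qed.

Lemma testbit_add_high n Z j : j < n -> Nat.testbit (2 ^ n + Z) j = Nat.testbit Z j.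
Proof.
  intros Hj. rewrite <- (Nat.mod_pow2_bits_low (2 ^ n + Z) n j Hj).
  rewrite <- (Nat.mod_pow2_bits_low Z n j Hj). f_equal.
  replace (2 ^ n + Z) with (Z + 1 * 2 ^ n) by lia. apply Nat.Div0.mod_add.
Qed.

(** Numbers below [2 ^ S n] are split by their top bit, which survival to depth [n] does not see;
    each half contributes at most the previous count. Hence the surviving fraction never
    increases. *)
Lemma surv_count_S X b n : surv_count X b (S n) <= 2 * surv_count X b n.
Proof.
  replace (2 * surv_count X b n) with (surv_count X b n + surv_count X b n) by lia.
  unfold surv_count. replace (2 ^ S n) with (2 ^ n + 2 ^ n) by (simpl; lia).
  rewrite seq_app, filter_app, length_app, Nat.add_0_l.
  replace (seq (2 ^ n) (2 ^ n)) with (map (fun Z => 2 ^ n + Z) (seq 0 (2 ^ n))).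
  2:{ apply nth_ext with (d := 2 ^ n) (d' := 2 ^ n).
      - now rewrite length_map, !length_seq.
      - rewrite length_map, length_seq. intros j Hj.
        rewrite (nth_indep _ _ (2 ^ n + 0)) by (rewrite length_map, length_seq; auto).
        rewrite (map_nth (fun Z => 2 ^ n + Z)), !seq_nth; auto. }
  rewrite filter_map_swap, length_map.
  apply Nat.add_le_mono; apply filter_length_le; intros Z HZ.
  - now apply surv_S_le.
  - apply surv_S_le in HZ. revert HZ. apply surv_ext. intros; now apply testbit_add_high.
Qed.

Lemma sparse_le X b n n' : n <= n' -> sparse X b n = true -> sparse X b n' = true.
Proof.
  induction 1 as [|n' _ IH]; auto. intros H. apply IH in H. unfold sparse in *.
  rewrite Nat.ltb_lt in *. pose proof (surv_count_S X b n'). simpl. lia.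
Qed.

Lemma all_sparse_le X b n n' q : n <= n' -> all_sparse X b n q = true -> all_sparse X b n' q = true.
Proof.
  unfold all_sparse. intros Hn. rewrite !forallb_seq_true. intros H m Hm.
  eapply sparse_le; eauto.
Qed.

(** Walks down the left spine: the first node is the right child of [b], the others hang from the
    left child. *)
Lemma all_sparse_S X b n q :
  all_sparse X b n (S q) = sparse X (2 * b + 1) n && all_sparse X (2 * b) n q.
Proof.
  unfold all_sparse. rewrite forallb_seq_S. f_equal.
  - f_equal. simpl. lia.
  - apply forallb_pointwise. intros m. f_equal. simpl. lia.
Qed.

(** * Descendants in the tree and dependence on coordinates *)

Definition dep {T} (A : nat -> Prop) (f : (nat -> nat) -> T) : Prop :=
  forall X X', (forall i, A i -> X i = X' i) -> f X = f X'.

(** In heap order, halving moves to the parent. *)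
Definition desc b c : Prop := exists d, c / 2 ^ d = b.

Lemma desc_refl b : desc b b.
Proof. exists 0. apply Nat.div_1_r. Qed.

Lemma desc_child b c e : e < 2 -> desc (2 * b + e) c -> desc b c.
Proof.
  intros He [d H]. exists (d + 1). rewrite Nat.pow_add_r, <- Nat.Div0.div_div, H.
  replace (2 * b + e) with (e + b * 2) by lia. change (2 ^ 1) with 2.
  rewrite Nat.div_add, Nat.div_small by lia. auto.
Qed.

Lemma desc_ge b c : desc b c -> b <= c.
Proof.
  intros [d <-]. apply Nat.Div0.div_le_upper_bound.
  pose proof (Nat.pow_nonzero 2 d ltac:(lia)). nia.
Qed.

(** Two ancestors of [c] at different heights are ancestors of one another, and a proper ancestor is
    at most half its descendant, which siblings violate. *)
Lemma desc_disjoint b c : 1 <= b -> desc (2 * b) c -> desc (2 * b + 1) c -> False.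
Proof.
  intros Hb [d H] [d' H'].
  assert (K : forall u v e, u / 2 ^ S e = v -> 2 * v <= u).
  { intros u v e <-. pose proof (Nat.Div0.mul_div_le u (2 ^ S e)).
    pose proof (Nat.pow_nonzero 2 e ltac:(lia)). rewrite Nat.pow_succ_r' in *. nia. }
  destruct (Nat.lt_trichotomy d d') as [L | [E | L]].
  - assert (E : c / 2 ^ d / 2 ^ S (d' - d - 1) = c / 2 ^ d').
    { rewrite Nat.Div0.div_div, <- Nat.pow_add_r. do 2 f_equal. lia. }
    rewrite H, H' in E. apply K in E. lia.
  - subst. lia.
  - assert (E : c / 2 ^ d' / 2 ^ S (d - d' - 1) = c / 2 ^ d).
    { rewrite Nat.Div0.div_div, <- Nat.pow_add_r. do 2 f_equal. lia. }
    rewrite H, H' in E. apply K in E. lia.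
Qed.

(* The coordinates of [X] labelling the descendants of [b] within [n] levels. *)
Definition below b n i : Prop := desc b (i + 2) /\ i < (b + 1) * 2 ^ n.
(** The strict version excludes the label of [b], so survival below [b] is independent of that
    label. *)
Definition sbelow b n i : Prop :=
  (desc (2 * b) (i + 2) \/ desc (2 * b + 1) (i + 2)) /\ i < (b + 1) * 2 ^ n.

Lemma sbelow_below b n i : sbelow b n i -> below b n i.
Proof.
  intros [[H | H] Hi]; split; auto.
  - apply (desc_child b _ 0); [lia|]. now rewrite Nat.add_0_r.
  - apply (desc_child b _ 1); [lia | auto].
Qed.

Lemma below_child b n e i : e < 2 -> below (2 * b + e) n i -> sbelow b (S n) i.
Proof.
  intros He [H Hi]. split.
  - destruct e as [|[|]]; [left | right | lia]; auto. now rewrite Nat.add_0_r in H.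
  - rewrite Nat.pow_succ_r'. nia.
Qed.

Lemma dep_branch_of_surv b ph n z : 2 <= b ->
  (forall z', dep (sbelow b n) (fun X => surv X b (S ph) n z')) ->
  dep (below b n) (fun X => branch X b ph n z).
Proof.
  intros Hb Hs X X' H. unfold branch. rewrite (H (b - 2)).
  - now rewrite !(Hs _ X X') by (intros i Hi; apply H, sbelow_below, Hi).
  - split; [replace (b - 2 + 2) with b by lia; apply desc_refl|].
    pose proof (Nat.pow_nonzero 2 n ltac:(lia)). nia.
Qed.

Lemma dep_surv n : forall b ph z, 1 <= b ->
  dep (sbelow b n) (fun X => surv X b ph n z).
Proof.
  induction n as [|n IH]; intros b ph z Hb X X' H; [reflexivity|].
  rewrite !surv_S. f_equal; (apply dep_branch_of_surv; [lia | intros z'; apply IH; lia |]);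
    intros i Hi; apply H.
  - apply (below_child b n 0); [lia | now rewrite Nat.add_0_r].
  - apply (below_child b n 1); [lia | auto].
Qed.

Lemma dep_branch b ph n z : 2 <= b -> dep (below b n) (fun X => branch X b ph n z).
Proof. intros Hb. apply dep_branch_of_surv; auto. intros z'. apply dep_surv. lia. Qed.

Lemma dep_sparse b n : 1 <= b -> dep (below b n) (fun X => sparse X b n).
Proof.
  intros Hb X X' H. unfold sparse, surv_count. do 3 f_equal. apply filter_ext. intros Z.
  apply dep_surv; auto. intros i Hi. now apply H, sbelow_below.
Qed.

Lemma dep_all_sparse n q : forall b, 1 <= b -> dep (below b (n + q)) (fun X => all_sparse X b n q).
Proof.
  induction q as [|q IH]; intros b Hb X X' H; [reflexivity|].
  rewrite !all_sparse_S. f_equal.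
  - apply dep_sparse; [lia|]. intros i [Hi Hi']. apply H. split.
    + apply (desc_child b _ 1); [lia | auto].
    + replace (n + S q) with (S n + q) by lia. rewrite Nat.pow_add_r, Nat.pow_succ_r'.
      pose proof (Nat.pow_nonzero 2 q ltac:(lia)). nia.
  - apply IH; [lia|]. intros i Hi. apply H, sbelow_below.
    replace (n + S q) with (S (n + q)) by lia.
    apply (below_child b _ 0); [lia | now rewrite Nat.add_0_r].
Qed.

(** * The measure of the test *)

Local Open Scope R_scope.

Definition ind (b : bool) : R := if b then 1 else 0.

Lemma ind_bounds b : 0 <= ind b <= 1.
Proof. destruct b; simpl; lra. Qed.

Lemma ind_andb a b : ind (a && b) = ind a * ind b.
Proof. destruct a, b; simpl; lra. Qed.

Definition upd (X : nat -> nat) i v : nat -> nat := fun j => if (j =? i)%nat then v else X j.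

Lemma upd_same X i v : upd X i v i = v.
Proof. unfold upd. now rewrite Nat.eqb_refl. Qed.

Lemma upd_other X i v j : j <> i -> upd X i v j = X j.
Proof. unfold upd. intros H. now rewrite (proj2 (Nat.eqb_neq j i)). Qed.

(* [avg i] integrates out the [i]-th ternary coordinate, and [Ex n] the first [n];
   [Ex n f X] is thus a conditional expectation given the coordinates of [X] from [n] on. *)
Definition avg i (f : (nat -> nat) -> R) : (nat -> nat) -> R :=
  fun X => (f (upd X i 0%nat) + f (upd X i 1%nat) + f (upd X i 2%nat)) / 3.

Fixpoint Ex (n : nat) (f : (nat -> nat) -> R) : (nat -> nat) -> R :=
  match n with O => f | S m => Ex m (avg m f) end.

Lemma Ex_le n : forall f g, (forall X, f X <= g X) -> forall X, Ex n f X <= Ex n g X.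
Proof.
  induction n as [|n IH]; intros f g H X; cbn [Ex]; auto.
  apply IH. intros Y. unfold avg.
  pose proof (H (upd Y n 0%nat)). pose proof (H (upd Y n 1%nat)). pose proof (H (upd Y n 2%nat)).
  lra.
Qed.

Lemma Ex_ext n f g X : (forall X, f X = g X) -> Ex n f X = Ex n g X.
Proof. intros H. apply Rle_antisym; apply Ex_le; intros; rewrite H; lra. Qed.

Lemma Ex_const n c X : Ex n (fun _ => c) X = c.
Proof.
  induction n as [|n IH]; cbn [Ex]; auto.
  transitivity (Ex n (fun _ => c) X); auto. apply Ex_ext. intros. unfold avg. field.
Qed.

Lemma Ex_lin n a : forall f g X,
  Ex n (fun X => a * f X + g X) X = a * Ex n f X + Ex n g X.
Proof.
  induction n as [|n IH]; intros f g X; cbn [Ex]; auto.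
  rewrite <- IH. apply Ex_ext. intros. unfold avg. field.
Qed.

Lemma Ex_add n f g X : Ex n (fun X => f X + g X) X = Ex n f X + Ex n g X.
Proof.
  rewrite <- (Rmult_1_l (Ex n f X)), <- Ex_lin. apply Ex_ext. intros. lra.
Qed.

Lemma Ex_scal n a f X : Ex n (fun X => a * f X) X = a * Ex n f X.
Proof.
  replace (a * Ex n f X) with (a * Ex n f X + Ex n (fun _ => 0) X) by (rewrite Ex_const; lra).
  rewrite <- Ex_lin. apply Ex_ext. intros. lra.
Qed.

Lemma Ex_one_sub n f X : Ex n (fun X => 1 - f X) X = 1 - Ex n f X.
Proof.
  replace (1 - Ex n f X) with (-1 * Ex n f X + Ex n (fun _ => 1) X) by (rewrite Ex_const; lra).
  rewrite <- Ex_lin. apply Ex_ext. intros. lra.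
Qed.

Lemma dep_comp {T U} (h : T -> U) A f : dep A f -> dep A (fun X => h (f X)).
Proof. intros H X X' HX. f_equal. auto. Qed.

Lemma avg_indep A i f X : dep A f -> ~ A i -> avg i f X = f X.
Proof.
  intros Hf Hi. unfold avg.
  assert (E : forall v, f (upd X i v) = f X).
  { intros v. apply Hf. intros j Hj. apply upd_other. congruence. }
  rewrite !E. field.
Qed.

Lemma dep_avg A i f : dep A f -> dep A (avg i f).
Proof.
  intros Hf X X' H. unfold avg.
  assert (E : forall v, f (upd X i v) = f (upd X' i v)).
  { intros v. apply Hf. intros j Hj. unfold upd. destruct (j =? i)%nat; auto. }
  now rewrite !E.
Qed.

(** Independence. At most one factor depends on the coordinate being integrated, so the other factor
    comes out of [avg]. *)
Lemma Ex_mul n A B : (forall i, A i -> B i -> False) -> forall f g X, dep A f -> dep B g ->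
  Ex n (fun X => f X * g X) X = Ex n f X * Ex n g X.
Proof.
  intros Hdis. induction n as [|n IH]; intros f g X Hf Hg; cbn [Ex]; auto.
  rewrite <- IH by now apply dep_avg. apply Ex_ext. clear X. intros X.
  destruct (classic (A n)) as [HA | HA].
  - assert (HB : ~ B n) by eauto. rewrite (avg_indep B n g) by auto. unfold avg.
    assert (E : forall v, g (upd X n v) = g X).
    { intros v. apply Hg. intros j Hj. apply upd_other. congruence. }
    rewrite !E. field.
  - rewrite (avg_indep A n f) by auto. unfold avg.
    assert (E : forall v, f (upd X n v) = f X).
    { intros v. apply Hf. intros j Hj. apply upd_other. congruence. }
    rewrite !E. field.
Qed.

Lemma Ex_coord n i h X : (i < n)%nat ->
  Ex n (fun X => h (X i)) X = (h 0%nat + h 1%nat + h 2%nat) / 3.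
Proof.
  induction n as [|n IH]; intros Hi; [lia|]. cbn [Ex].
  destruct (Nat.eq_dec i n) as [-> | Hn].
  - rewrite <- (Ex_const n ((h 0%nat + h 1%nat + h 2%nat) / 3) X).
    apply Ex_ext. intros Y. unfold avg. now rewrite !upd_same.
  - rewrite <- IH by lia. apply Ex_ext. intros Y. unfold avg. rewrite !upd_other by auto. field.
Qed.

(* A subsolution of the survival recursion [p (ph) = 1 - (1 - kappa ph * p (ph + 1))^2]. *)
Definition alpha (ph : nat) : R :=
  match ph mod 3 with 0 => 1 / 10 | 1 => 84 / 1000 | _ => 65 / 1000 end.

(** The probability that a label is acceptable: the required bit or 2 in phases 0 and 1, only the
    required bit in phase 2. *)
Definition kappa (ph : nat) : R := if (ph mod 3 =? 2)%nat then 1 / 3 else 2 / 3.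

(** Going backwards from 1/10 in phase 0, the recursion gives about 0.0656 in phase 2, rounded down
    to 0.065, then about 0.0848 in phase 1, rounded down to 0.084, then about 0.1089 in phase 0,
    above 1/10, which closes the cycle. *)
Lemma alpha_kappa ph :
  0 <= kappa ph * alpha (S ph) <= 1 /\
  alpha ph <= 1 - (1 - kappa ph * alpha (S ph)) * (1 - kappa ph * alpha (S ph)).
Proof.
  unfold alpha, kappa. rewrite <- (Nat.add_1_r ph), (Nat.Div0.add_mod ph 1).
  pose proof (Nat.mod_upper_bound ph 3 ltac:(lia)).
  destruct (ph mod 3) as [|[|[|]]]; try lia; simpl; lra.
Qed.

Lemma alpha_bounds ph : 0 <= alpha ph <= 1.
Proof. unfold alpha. destruct (ph mod 3) as [|[|]]; lra. Qed.

Lemma ind_orb a b : ind (a || b) = 1 - (1 - ind a) * (1 - ind b).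
Proof. destruct a, b; simpl; lra. Qed.

Lemma Ex_branch_surv N b ph n z X :
  (2 <= b)%nat -> (b - 2 < N)%nat ->
  (forall z, alpha (S ph) <= Ex N (fun X => ind (surv X b (S ph) n z)) X) ->
  kappa ph * alpha (S ph) <= Ex N (fun X => ind (branch X b ph n z)) X.
Proof.
  intros Hb HN H.
  assert (Hdis : forall i, i = (b - 2)%nat -> sbelow b n i -> False).
  { intros i -> [[K | K] _]; apply desc_ge in K; lia. }
  assert (Hmul : forall h z, Ex N (fun X => ind (h (X (b - 2)%nat)) * ind (surv X b (S ph) n z)) X
    = (ind (h 0%nat) + ind (h 1%nat) + ind (h 2%nat)) / 3
      * Ex N (fun X => ind (surv X b (S ph) n z)) X).
  { intros h z'. rewrite (Ex_mul N (fun i => i = (b - 2)%nat) (sbelow b n)); auto.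
    - rewrite (Ex_coord N (b - 2) (fun v => ind (h v))); auto.
    - intros Y Y' E. now rewrite E.
    - apply dep_comp, dep_surv. lia. }
  set (h2 := fun v => (v =? 2)%nat && negb (ph mod 3 =? 2)%nat).
  set (hz := fun v => (v =? Nat.b2n (z 0%nat))%nat).
  (* The two ways to pass through [b], by a 2 or by the right bit, are disjoint, so their indicators
     add; each is a product of independent factors. *)
  rewrite (Ex_ext N _ (fun X => ind (h2 (X (b - 2)%nat)) * ind (surv X b (S ph) n z)
                  + ind (hz (X (b - 2)%nat)) * ind (surv X b (S ph) n (shift z)))).
  - rewrite Ex_add, !Hmul. pose proof (H z). pose proof (H (shift z)).
    unfold kappa, h2, hz. destruct (ph mod 3 =? 2)%nat, (z 0%nat); simpl; lra.
  - intros Y. unfold branch, h2, hz. destruct (Nat.eqb_spec (Y (b - 2)%nat) 2) as [-> | _].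
    + rewrite !ind_andb. destruct (z 0%nat); simpl; lra.
    + rewrite !ind_andb. simpl. lra.
Qed.

(** Extinction requires both children to fail, and these failures are independent, so [alpha_kappa]
    carries the induction. The bound on [N] makes [Ex] integrate every label that is read. *)
Lemma Ex_surv N X n : forall b ph z, (1 <= b)%nat -> ((b + 1) * 2 ^ n <= N)%nat ->
  alpha ph <= Ex N (fun X => ind (surv X b ph n z)) X.
Proof.
  induction n as [|n IH]; intros b ph z Hb HN.
  - change (fun X => ind (surv X b ph 0 z)) with (fun _ : nat -> nat => 1).
    rewrite Ex_const. apply alpha_bounds.
  - pose proof (Nat.pow_nonzero 2 n ltac:(lia)) as Hn. rewrite Nat.pow_succ_r' in HN.
    assert (Hbr : forall e, (e < 2)%nat ->
      kappa ph * alpha (S ph) <= Ex N (fun X => ind (branch X (2 * b + e) ph n z)) X).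
    { intros e He. apply Ex_branch_surv; [lia | nia |]. intros z'. apply IH; nia. }
    pose proof (Hbr 0%nat ltac:(lia)) as H0. pose proof (Hbr 1%nat ltac:(lia)) as H1.
    rewrite Nat.add_0_r in H0.
    rewrite (Ex_ext N _ (fun X => 1 - (1 - ind (branch X (2 * b) ph n z)) *
                                    (1 - ind (branch X (2 * b + 1) ph n z))))
      by (intros Y; rewrite surv_S, ind_orb; auto).
    rewrite Ex_one_sub, (Ex_mul N (below (2 * b) n) (below (2 * b + 1) n)), !Ex_one_sub.
    + assert (Hle : forall f : (nat -> nat) -> bool, Ex N (fun X => ind (f X)) X <= 1).
      { intros f. apply Rle_trans with (Ex N (fun _ => 1) X); [| rewrite Ex_const; lra].
        apply Ex_le. intros; apply ind_bounds. }
      pose proof (Hle (fun X => branch X (2 * b) ph n z)).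
      pose proof (Hle (fun X => branch X (2 * b + 1) ph n z)).
      destruct (alpha_kappa ph) as [K1 K2]. cbv beta in *.
      eapply Rle_trans; [apply K2|]. apply Rplus_le_compat_l, Ropp_le_contravar.
      apply Rmult_le_compat; lra.
    + intros i [K _] [K' _]. eapply desc_disjoint; eauto.
    + apply (dep_comp (fun b => 1 - ind b)), dep_branch. lia.
    + apply (dep_comp (fun b => 1 - ind b)), dep_branch. lia.
Qed.

Lemma Ex_count {T} N X (g : (nat -> nat) -> T -> bool) a l :
  (forall t, In t l -> a <= Ex N (fun X => ind (g X t)) X) ->
  INR (length l) * a <= Ex N (fun X => INR (length (filter (g X) l))) X.
Proof.
  intros H. induction l as [|t l IH].
  - simpl. rewrite Ex_const. lra.
  - rewrite (Ex_ext N _ (fun X => ind (g X t) + INR (length (filter (g X) l)))).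
    + rewrite Ex_add. simpl length. rewrite S_INR.
      specialize (IH (fun t Ht => H t (or_intror Ht))). specialize (H t (or_introl eq_refl)). lra.
    + intros Y. simpl. destruct (g Y t); simpl length; rewrite ?S_INR; simpl ind; lra.
Qed.

(* Reverse Markov: the surviving fraction is at most 1 and has mean at least 1/10. *)
Lemma Ex_sparse N X b n : (1 <= b)%nat -> ((b + 1) * 2 ^ n <= N)%nat ->
  Ex N (fun X => ind (sparse X b n)) X <= 19 / 20.
Proof.
  intros Hb HN.
  pose proof (Ex_count N X (fun X Z => surv X b 0 n (Nat.testbit Z)) (1 / 10)
                (seq 0 (2 ^ n))) as H.
  rewrite length_seq in H.
  assert (Hpos : 0 < INR (2 ^ n)).
  { apply lt_0_INR. pose proof (Nat.pow_nonzero 2 n ltac:(lia)). lia. }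
  assert (H' : INR (2 ^ n) * (1 / 10) <= Ex N (fun X => INR (2 ^ n) * (1 / 20 + (1 - ind (sparse X b n)))) X).
  { eapply Rle_trans; [apply H|].
    - intros Z _. apply (Ex_surv N X n b 0); auto.
    - apply Ex_le. intros Y. change (length _) with (surv_count Y b n). unfold sparse.
      destruct (Nat.ltb_spec (20 * surv_count Y b n) (2 ^ n)) as [L | L]; simpl ind.
      + apply lt_INR in L. rewrite mult_INR in L. simpl (INR 20) in L. lra.
      + assert (C : (surv_count Y b n <= 2 ^ n)%nat).
        { unfold surv_count. eapply Nat.le_trans; [apply List.filter_length_le|].
          now rewrite length_seq. }
        apply le_INR in C. lra. }
  rewrite Ex_scal, Ex_add, Ex_const, Ex_one_sub in H'.
  apply Rmult_le_reg_l in H'; [lra | auto].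
Qed.

Lemma Ex_all_sparse N X n q : forall b, (1 <= b)%nat -> ((b + 1) * 2 ^ (n + q) <= N)%nat ->
  0 <= Ex N (fun X => ind (all_sparse X b n q)) X <= (19 / 20) ^ q.
Proof.
  induction q as [|q IH]; intros b Hb HN.
  - change (fun X => ind (all_sparse X b n 0)) with (fun _ : nat -> nat => 1).
    rewrite Ex_const. simpl. lra.
  - replace (n + S q)%nat with (S (n + q)) in HN by lia.
    rewrite Nat.pow_succ_r' in HN. pose proof (Nat.pow_nonzero 2 (n + q) ltac:(lia)).
    assert (Hnq : (2 ^ n <= 2 ^ (n + q))%nat) by (apply Nat.pow_le_mono_r; lia).
    rewrite (Ex_ext N _ (fun X => ind (sparse X (2 * b + 1) n) * ind (all_sparse X (2 * b) n q)))
      by (intros; rewrite all_sparse_S; apply ind_andb).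
    rewrite (Ex_mul N (below (2 * b + 1) n) (below (2 * b) (n + q))).
    + pose proof (Ex_sparse N X (2 * b + 1) n ltac:(lia) ltac:(nia)).
      destruct (IH (2 * b)%nat ltac:(lia) ltac:(nia)).
      assert (0 <= Ex N (fun X => ind (sparse X (2 * b + 1) n)) X).
      { rewrite <- (Ex_const N 0 X). apply Ex_le. intros; apply ind_bounds. }
      cbn [pow]. split; [apply Rmult_le_pos | apply Rmult_le_compat]; auto.
    + intros i [K _] [K' _]. eapply desc_disjoint; eauto.
    + apply (dep_comp ind), dep_sparse. lia.
    + apply (dep_comp ind), dep_all_sparse. lia.
Qed.

(** * Cylinders and the measure of the test *)

Definition extends (t : list trit) (X : nat -> nat) : bool :=
  forallb (fun k => X k =? digits t k)%nat (seq 0 (length t)).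

Lemma extends_iff t X : extends t X = true <-> forall k, (k < length t)%nat -> X k = digits t k.
Proof.
  unfold extends. rewrite forallb_seq_true. setoid_rewrite Nat.eqb_eq. reflexivity.
Qed.

Lemma Ex_extends t N X : (length t <= N)%nat -> Ex N (fun X => ind (extends t X)) X = (/ 3) ^ length t.
Proof.
  revert N. induction t as [|c t IH] using rev_ind; intros N HN.
  - simpl. apply Ex_const.
  - rewrite length_app in *. simpl length in *.
    rewrite (Ex_ext N _ (fun X => ind (extends t X) * ind (X (length t) =? trit_nat c)%nat)).
    + rewrite (Ex_mul N (fun i => (i < length t)%nat) (fun i => i = length t)).
      * rewrite IH, (Ex_coord N _ (fun v => ind (v =? trit_nat c)%nat)) by lia.
        rewrite Nat.add_1_r. cbn [pow]. destruct c; simpl; field.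
      * intros; lia.
      * intros Y Y' E. f_equal. apply eq_true_iff_eq. rewrite !extends_iff.
        split; intros K k Hk; [rewrite <- E | rewrite E]; auto.
      * intros Y Y' E. now rewrite E.
    + intros Y. rewrite <- ind_andb. f_equal. unfold extends.
      rewrite length_app. simpl length. rewrite Nat.add_1_r, seq_S, forallb_app. simpl.
      rewrite andb_true_r. f_equal.
      * apply eq_true_iff_eq. rewrite !forallb_seq_true.
        unfold digits. split; intros K k Hk; specialize (K k Hk); rewrite app_nth1 in *; auto.
      * unfold digits. now rewrite nth_middle.
Qed.

Lemma digits_inj s t : length s = length t -> (forall k, (k < length s)%nat -> digits s k = digits t k) -> s = t.
Proof.
  intros L H. apply nth_ext with (d := T0) (d' := T0); auto. intros k Hk.
  specialize (H k Hk). unfold digits in H. destruct (nth k s T0), (nth k t T0); simpl in H; congruence.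
Qed.

(** The cylinders of the strings in [L] are disjoint, have measure [(/ 3) ^ n] each, and lie in the
    event that all [14 * i] nodes are sparse at depth [n]. *)
Lemma lam3_rtest i : lam3_open_le (rtest i) i.
Proof.
  intros n L [HND HL].
  set (q := (14 * i)%nat). set (N := (n + 2 * 2 ^ (n + q))%nat).
  set (X0 := fun _ : nat => 0%nat).
  assert (Hup : Ex N (fun X => ind (all_sparse X 1 n q)) X0 <= (19 / 20) ^ q).
  { apply Ex_all_sparse; [lia|]. unfold N. change (1 + 1)%nat with 2%nat. lia. }
  assert (Hlow : INR (length L) * (/ 3) ^ n <= Ex N (fun X => ind (all_sparse X 1 n q)) X0).
  { eapply Rle_trans;
      [apply (Ex_count N X0 (fun X t => extends t X)) | apply Ex_le; intros X].
    - intros t Ht. destruct (HL t Ht) as [Hn _]. rewrite Ex_extends, Hn; [lra|]. unfold N. lia.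
    - assert (HF : forall t, In t (filter (fun t => extends t X) L) ->
        length t = n /\ (forall k, (k < n)%nat -> X k = digits t k) /\ all_sparse X 1 n q = true).
      { intros t Ht. apply filter_In in Ht. destruct Ht as [Ht HX].
        destruct (HL t Ht) as [Hn [s [[n' [Hs Hbad]] [u ->]]]].
        rewrite extends_iff, Hn in HX. repeat split; auto.
        rewrite length_app in Hn.
        pose proof (Nat.pow_gt_lin_r 2 (14 * i + n' + 3) ltac:(lia)).
        (* The length condition of [rtest] gives [n' < n], so sparseness at depth [n'] passes to
           depth [n]. *)
        apply (all_sparse_le X 1 n'); [lia|]. fold q in Hbad. rewrite <- Hbad.
        apply (dep_all_sparse n' q 1); auto. intros k [_ Hk]. rewrite HX.
        + unfold digits. rewrite app_nth1; auto.
          replace (14 * i + n' + 3)%nat with (S (S (S (n' + q)))) in Hs by (unfold q; lia).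
          rewrite !Nat.pow_succ_r' in Hs. lia.
        + replace (14 * i + n' + 3)%nat with (S (S (S (n' + q)))) in Hs by (unfold q; lia).
          rewrite !Nat.pow_succ_r' in Hs. lia. }
      (* A given [X] extends at most one string of length [n], so the filtered list has at most one
         entry. *)
      pose proof (NoDup_filter (fun t => extends t X) HND) as HND'.
      destruct (filter (fun t => extends t X) L) as [|t [|t' l]].
      + apply ind_bounds.
      + destruct (HF t (or_introl eq_refl)) as [_ [_ ->]]. simpl. lra.
      + exfalso. inversion HND' as [|? ? Hnin _]; subst. apply Hnin. left.
        destruct (HF t (or_introl eq_refl)) as [L1 [E1 _]].
        destruct (HF t' (or_intror (or_introl eq_refl))) as [L2 [E2 _]].
        apply digits_inj; [congruence|]. intros k Hk. rewrite <- E2, <- E1; auto; lia. }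
  (* 14 is the least exponent bringing 19/20 down to at most 1/2. *)
  assert (Hq : (19 / 20) ^ q <= (/ 2) ^ i).
  { unfold q. rewrite pow_mult. apply pow_incr. split; [apply pow_le|]; simpl; lra. }
  assert (H : INR (length L) * (/ 3) ^ n <= (/ 2) ^ i) by lra.
  rewrite !pow_inv in H.
  apply INR_le. rewrite mult_INR, !pow_INR.
  change (INR 2) with 2. replace (INR 3) with 3 by (simpl; lra).
  assert (H2 : 0 < 2 ^ i) by (apply pow_lt; lra).
  assert (H3 : 0 < 3 ^ n) by (apply pow_lt; lra).
  apply (Rmult_le_compat_r (2 ^ i * 3 ^ n)) in H; [| apply Rmult_le_pos; lra].
  replace (/ 2 ^ i * (2 ^ i * 3 ^ n)) with (3 ^ n) in H by (field; lra).
  replace (INR (length L) * / 3 ^ n * (2 ^ i * 3 ^ n)) with (INR (length L) * 2 ^ i) in H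
    by (field; lra).
  exact H.
Qed.

Local Close Scope R_scope.

(** * From surviving nodes to the range *)

Lemma prefix_of_map {A} (s : list A) : forall w, prefix_of s w -> s = map w (seq 0 (length s)).
Proof.
  induction s as [|a s IH]; intros w H; auto. simpl. f_equal.
  - specialize (H 0 ltac:(simpl; lia)). simpl in H. congruence.
  - rewrite <- seq_shift, map_map. apply (IH (shift w)).
    intros k Hk. apply (H (S k)). simpl. lia.
Qed.

Lemma map_prefix_of {A} (w : nat -> A) n : prefix_of (map w (seq 0 n)) w.
Proof.
  intros k Hk. rewrite length_map, length_seq in Hk.
  rewrite nth_error_map, (nth_error_nth' _ 0), seq_nth by (rewrite ?length_seq; auto). reflexivity.
Qed.

Lemma is_prefix_map {A} (s : list A) w n :
  prefix_of s w -> length s <= n -> is_prefix s (map w (seq 0 n)).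
Proof.
  intros H Hn. exists (map w (seq (length s) (n - length s))).
  rewrite (prefix_of_map s w H) at 1. rewrite <- map_app, <- seq_app. do 2 f_equal. lia.
Qed.

Lemma nat_bounded_choice (Q : nat -> nat -> Prop) m :
  (forall j n n', n <= n' -> Q j n -> Q j n') ->
  (forall j, j < m -> exists n, Q j n) -> exists n, forall j, j < m -> Q j n.
Proof.
  intros Hmono. induction m as [|m IH]; intros H.
  - exists 0. lia.
  - destruct IH as [n Hn]; [auto|]. destruct (H m) as [n' Hn']; [lia|].
    exists (Nat.max n n'). intros j Hj. destruct (Nat.eq_dec j m) as [-> | Hjm].
    + apply (Hmono m n'); auto; lia.
    + apply (Hmono j n); [lia|]. apply Hn. lia.
Qed.

(** A string is [Good] if it extends to solutions of every level. If no one-letter extension were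
    good, then, the alphabet being finite and [P] monotone, all would fail at a common level.
    Iterated choice of good letters builds the branch. *)
Lemma koenig {A} (l : list A) (P : nat -> (nat -> A) -> Prop) :
  (forall a, In a l) ->
  (forall n w w', (forall j, j < n -> w j = w' j) -> P n w -> P n w') ->
  (forall n n' w, n <= n' -> P n' w -> P n w) ->
  (forall n, exists w, P n w) -> exists w, forall n, P n w.
Proof.
  intros Hl Hext Hmono Hex.
  assert (HA : inhabited A) by (destruct (Hex 0) as [w _]; exact (inhabits (w 0))).
  set (Good := fun s => forall n, exists w, prefix_of s w /\ P n w).
  assert (Hstep : forall s, Good s -> exists a, Good (s ++ [a])).
  { intros s Hs. apply NNPP. intros Hno. pose proof (not_ex_all_not _ _ Hno) as Hno'.
    destruct HA as [a0].
    destruct (nat_bounded_choice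
      (fun j n => ~ exists w, prefix_of (s ++ [nth j l a0]) w /\ P n w) (length l)) as [N HN].
    - intros j n n' Hn H [w [Hw HP]]. apply H. exists w. eauto.
    - intros j _. specialize (Hno' (nth j l a0)). now apply not_all_ex_not in Hno'.
    - destruct (Hs N) as [w [Hw HP]].
      destruct (In_nth l (w (length s)) a0 (Hl _)) as [j [Hj Ej]].
      apply (HN j Hj). exists w. split; auto. rewrite Ej. intros k Hk.
      rewrite length_app in Hk. simpl in Hk.
      destruct (Nat.lt_ge_cases k (length s)) as [K | K].
      + rewrite nth_error_app1; auto.
      + replace k with (length s) by lia. rewrite nth_error_app2, Nat.sub_diag; auto. }
  set (next := fun s => epsilon HA (fun a => Good (s ++ [a]))).
  set (br := fix br n := match n with 0 => [] | S n => br n ++ [next (br n)] end).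
  assert (Hbr : forall n, Good (br n)).
  { induction n as [|n IH].
    - intros n. destruct (Hex n) as [w Hw]. exists w. split; auto. intros k Hk. inversion Hk.
    - apply (epsilon_spec HA (fun a => Good (br n ++ [a]))). auto. }
  assert (Emap : forall n, br n = map (fun k => next (br k)) (seq 0 n)).
  { induction n as [|n IH]; auto. rewrite seq_S, map_app, <- IH. reflexivity. }
  exists (fun k => next (br k)). intros n. destruct (Hbr n n) as [w [Hw HP]].
  apply (Hext n w); auto. intros j Hj.
  assert (Ew : Some (w j) = Some (next (br j))); [| congruence].
  rewrite <- Hw by (rewrite Emap, length_map, length_seq; auto).
  rewrite Emap. apply (map_prefix_of (fun k => next (br k)) n).
  now rewrite length_map, length_seq.
Qed.

Lemma testbit_inj n Z Z' : Z < 2 ^ n -> Z' < 2 ^ n ->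
  (forall j, j < n -> Nat.testbit Z j = Nat.testbit Z' j) -> Z = Z'.
Proof.
  intros HZ HZ' H. apply Nat.bits_inj. intros j.
  destruct (Nat.lt_ge_cases j n) as [K | K]; auto.
  rewrite <- (Nat.mod_small Z (2 ^ n)), <- (Nat.mod_small Z' (2 ^ n)) by auto.
  rewrite !Nat.mod_pow2_bits_high; auto.
Qed.

(** * Concatenation of paths, and outputs along a path *)

Definition splice {A} r (t z : nat -> A) : nat -> A :=
  fun k => if k <? r then t k else z (k - r).

Lemma splice_lt {A} r (t z : nat -> A) k : k < r -> splice r t z k = t k.
Proof. intros H. unfold splice. now rewrite (proj2 (Nat.ltb_lt k r)). Qed.

Lemma splice_add {A} r (t z : nat -> A) k : splice r t z (r + k) = z k.
Proof.
  unfold splice. rewrite (proj2 (Nat.ltb_ge (r + k) r)) by lia. f_equal. lia.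
Qed.

Lemma node_splice b M y0 y n :
  node b (splice M y0 y) (M + n) = node (node b y0 M) y n.
Proof.
  induction n as [|n IH].
  - rewrite Nat.add_0_r. cbn [node]. apply node_ext. intros. now apply splice_lt.
  - rewrite Nat.add_succ_r. cbn [node]. now rewrite IH, splice_add.
Qed.

Lemma label_splice X b M y0 y n : label X b (splice M y0 y) (M + n) = label X (node b y0 M) y n.
Proof. unfold label. now rewrite <- node_splice, Nat.add_succ_r. Qed.

Lemma outputs_splice X b M y0 y n :
  outputs X b (splice M y0 y) (M + n) = outputs X b y0 M + outputs X (node b y0 M) y n.
Proof.
  induction n as [|n IH].
  - cbn [outputs]. rewrite !Nat.add_0_r. apply outputs_ext. intros. now apply splice_lt.
  - rewrite Nat.add_succ_r. cbn [outputs]. rewrite IH, label_splice. lia.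
Qed.

Lemma outputs_mono X b y n n' : n <= n' -> outputs X b y n <= outputs X b y n'.
Proof. induction 1; cbn [outputs]; lia. Qed.

Lemma outputs_lt X b y n n' : n < n' -> label X b y n <> 2 -> outputs X b y n < outputs X b y n'.
Proof.
  intros Hn H. apply Nat.lt_le_trans with (outputs X b y (S n)); [| now apply outputs_mono].
  cbn [outputs]. rewrite (proj2 (Nat.eqb_neq _ _) H). lia.
Qed.

Lemma outputs_crossing X b y k N : k < outputs X b y N ->
  exists n, outputs X b y n = k /\ label X b y n <> 2.
Proof.
  induction N as [|N IH]; cbn [outputs]; [lia|]. intros H.
  destruct (Nat.eqb_spec (label X b y N) 2) as [E | E]; [apply IH; lia|].
  destruct (Nat.lt_ge_cases k (outputs X b y N)); [auto|]. exists N. split; auto. lia.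
Qed.

(** Provides the output bits already fixed on the way to a node. The value set at stage [N] has a
    larger index than every earlier output, so nothing is overwritten. *)
Lemma output_exists X b y N : (forall k, X k < 3) ->
  exists t : nat -> bool, forall n, n < N ->
    label X b y n = 2 \/ label X b y n = Nat.b2n (t (outputs X b y n)).
Proof.
  intros HX. induction N as [|N [t Ht]].
  - exists (fun _ => true). lia.
  - exists (fun k => if k =? outputs X b y N then label X b y N =? 1 else t k). intros n Hn.
    destruct (Nat.eq_dec (label X b y n) 2) as [E | E]; [auto | right].
    destruct (Nat.eq_dec n N) as [-> | HnN].
    + rewrite Nat.eqb_refl. unfold label in *. specialize (HX (node b y (S N) - 2)).
      destruct (X _) as [|[|[|]]]; auto; lia.
    + pose proof (outputs_lt X b y n N ltac:(lia) E).
      rewrite (proj2 (Nat.eqb_neq _ _)) by lia. destruct (Ht n); [lia | contradiction | auto].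
Qed.

(** Each block of three levels contains one in phase 2, where a bit must be output. *)
Lemma ok_outputs X b y z k : (forall n, ok X b 0 y z n = true) -> k <= outputs X b y (3 * k).
Proof.
  intros H. induction k as [|k IH]; [lia|].
  assert (E : label X b y (3 * k + 2) <> 2).
  { intros E. specialize (H (3 * k + 3)). unfold ok in H. rewrite forallb_seq_true in H.
    specialize (H (3 * k + 2) ltac:(lia)). rewrite E in H. simpl Nat.eqb in H at 1.
    rewrite Nat.add_0_l, Nat.add_comm, Nat.mul_comm, Nat.Div0.mod_add in H. discriminate. }
  pose proof (outputs_lt X b y (3 * k + 2) (3 * S k) ltac:(lia) E).
  pose proof (outputs_mono X b y (3 * k) (3 * k + 2) ltac:(lia)). lia.
Qed.

(** * Translation between [F_graph] and heap numbering *)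

Lemma idx_node y n : idx y n + 1 = node 1 y n.
Proof. induction n as [|n IH]; auto. cbn [idx node]. rewrite <- IH. unfold Nat.b2n. lia. Qed.

Lemma lab_label x y n : trit_nat (lab x y n) = label (fun k => trit_nat (x k)) 1 y n.
Proof. unfold lab, label. rewrite <- idx_node. do 2 f_equal. lia. Qed.

Lemma count_non2_outputs x y n : count_non2 x y n = outputs (fun k => trit_nat (x k)) 1 y n.
Proof.
  induction n as [|n IH]; auto. cbn [count_non2 outputs]. rewrite IH, <- lab_label.
  destruct (lab x y n); reflexivity.
Qed.

Lemma F_graph_intro x y z : let X := fun k => trit_nat (x k) in
  (forall n, label X 1 y n = 2 \/ label X 1 y n = Nat.b2n (z (outputs X 1 y n))) ->
  (forall k, exists n, k < outputs X 1 y n) -> F_graph x y z.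
Proof.
  intros X H Hinf k. destruct (Hinf k) as [N HN].
  destruct (outputs_crossing _ _ _ _ _ HN) as [n [E Hn]]. exists n.
  rewrite count_non2_outputs. split; auto.
  destruct (H n) as [K | K]; [contradiction|]. rewrite E in K. unfold X in K.
  rewrite <- lab_label in K. destruct (lab x y n), (z k); simpl in K; auto; discriminate.
Qed.

(** Otherwise every node 0^m 1 becomes sparse at some depth; by monotonicity the first [14 * i]
    share a depth [N], and a long enough prefix of [x] enters [rtest i] for every [i]. *)
Lemma random_surv x : ML_random3 x ->
  exists m, forall n, 2 ^ n <= 20 * surv_count (fun k => trit_nat (x k)) (2 ^ S m + 1) n.
Proof.
  intros Hx. set (X := fun k => trit_nat (x k)). apply NNPP. intros Hno.
  apply (Hx rtest unif_sigma01_rtest lam3_rtest). intros i.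
  destruct (nat_bounded_choice (fun m n => sparse X (2 ^ S m + 1) n = true) (14 * i)) as [N HN].
  { intros m n n' Hn. now apply sparse_le. }
  { intros m _. pose proof (not_ex_all_not _ _ Hno m) as Hm.
    apply not_all_ex_not in Hm. destruct Hm as [n Hn]. exists n. apply Nat.ltb_lt. lia. }
  exists (map x (seq 0 (S (2 ^ (14 * i + N + 3))))). split; [| apply map_prefix_of].
  exists N. split; [rewrite length_map, length_seq; lia|].
  transitivity (all_sparse X 1 N (14 * i)).
  - apply (dep_all_sparse N (14 * i) 1); auto. intros k [_ Hk]. unfold digits, X.
    replace (14 * i + N + 3) with (S (S (S (N + 14 * i)))) by lia.
    rewrite !Nat.pow_succ_r'.
    rewrite (nth_indep _ T0 (x 0)), map_nth, seq_nth by (rewrite ?length_map, ?length_seq; lia).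
    reflexivity.
  - unfold all_sparse. apply forallb_seq_true. intros m Hm. rewrite Nat.mul_1_l. auto.
Qed.

Theorem theorem6p3 (x : nat -> trit) :
  ML_random3 x -> lam_pos (ran_F x).
Proof.
  intros Hx. destruct (random_surv x Hx) as [m Hm].
  (* The first [S m] steps of [y0] are 0^m 1 and lead to the node found. *)
  set (X := fun k => trit_nat (x k)) in *. set (y0 := fun j => j =? m).
  assert (Hnode : node 1 y0 (S m) = 2 ^ S m + 1).
  { assert (E : forall k, k <= m -> node 1 y0 k = 2 ^ k).
    { induction k as [|k IH]; intros Hk; auto. cbn [node]. unfold y0 at 2.
      rewrite IH, (proj2 (Nat.eqb_neq k m)) by lia. simpl. lia. }
    cbn [node]. rewrite E by lia. unfold y0. rewrite Nat.eqb_refl. reflexivity. }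
  set (b := 2 ^ S m + 1) in *. set (r := outputs X 1 y0 (S m)).
  destruct (output_exists X 1 y0 (S m)) as [t Ht].
  { intros k. unfold X. destruct (x k); simpl; lia. }
  (* The [r] bits output before reaching [b] cost a factor [2 ^ r]; the 5 comes from 1/20 > 1/32. *)
  exists (r + 5). intros W HW. apply NNPP. intros Hno.
  (* Compactness is applied to pairs of a path below [b] and its output that avoid [W] up to length
     [r + n]; an infinite branch yields a point of the range outside the cover. *)
  destruct (koenig [(true, true); (true, false); (false, true); (false, false)]
    (fun n w => ok X b 0 (fun k => fst (w k)) (fun k => snd (w k)) n = true /\
       ~ exists s, W s /\ length s <= r + n /\ prefix_of s (splice r t (fun k => snd (w k)))))
    as [w Hw].
  - intros [[] []]; simpl; auto.
  - intros n w w' E [H1 H2]. split.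
    + revert H1. apply ok_ext; intros; now rewrite E.
    + intros [s [Hs [Hl Hp]]]. apply H2. exists s. repeat split; auto.
      intros k Hk. rewrite Hp by auto. f_equal. unfold splice.
      destruct (Nat.ltb_spec k r); auto. rewrite E; auto. lia.
  - intros n n' w Hn [H1 H2]. split; [eapply ok_le; eauto|].
    intros [s [Hs [Hl Hp]]]. apply H2. exists s. repeat split; auto. lia.
  (* If no pair exists at level [n], all surviving outputs, prefixed by [t], are covered by [W];
     they are numerous enough to contradict [Hno]. *)
  - intros n. apply NNPP. intros Hcov. apply Hno.
    exists (r + n), (map (fun Z => map (splice r t (Nat.testbit Z)) (seq 0 (r + n)))
      (filter (fun Z => surv X b 0 n (Nat.testbit Z)) (seq 0 (2 ^ n)))).
    split; [split|].
    + apply NoDup_map_NoDup_ForallPairs; [| apply NoDup_filter, seq_NoDup].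
      intros Z Z' HZ HZ' E. apply filter_In in HZ, HZ'. rewrite !in_seq in *.
      apply (testbit_inj n); [lia | lia |]. intros j Hj.
      rewrite <- (splice_add r t (Nat.testbit Z)), <- (splice_add r t (Nat.testbit Z')).
      apply (f_equal (fun l => nth_error l (r + j))) in E.
      rewrite !map_prefix_of in E by (rewrite length_map, length_seq; lia). congruence.
    + intros u Hu. apply in_map_iff in Hu. destruct Hu as [Z [<- HZ]].
      split; [now rewrite length_map, length_seq|].
      apply filter_In in HZ. destruct HZ as [_ HZ]. apply surv_iff in HZ.
      destruct HZ as [y Hy]. apply NNPP. intros Hs. apply Hcov.
      exists (fun k => (y k, Nat.testbit Z k)). split; [exact Hy|].
      intros [s [HWs [Hl Hp]]]. apply Hs. exists s. split; auto. now apply is_prefix_map.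
    + rewrite length_map. change (length _) with (surv_count X b n). specialize (Hm n).
      rewrite !Nat.pow_add_r. change (2 ^ 5) with 32.
      pose proof (Nat.pow_nonzero 2 n ltac:(lia)). pose proof (Nat.pow_nonzero 2 r ltac:(lia)).
      nia.
  - set (y := fun k => fst (w k)) in *. set (z := fun k => snd (w k)) in *.
    assert (Hok : forall n, ok X b 0 y z n = true) by (intros; apply Hw).
    destruct (HW (splice r t z)) as [s [Hs Hp]].
    + exists (splice (S m) y0 y). apply F_graph_intro; fold X.
      * intros n. destruct (Nat.lt_ge_cases n (S m)) as [K | K].
        { rewrite (label_ext X 1 _ y0), (outputs_ext X 1 _ y0)
            by (intros; apply splice_lt; lia).
          destruct (Ht n K) as [E | E]; [auto|].
          destruct (Nat.eq_dec (label X 1 y0 n) 2) as [E2 | E2]; [auto | right].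
          rewrite splice_lt; auto. now apply outputs_lt. }
        { replace n with (S m + (n - S m)) by lia. generalize (n - S m) as k. intros k.
          rewrite label_splice, outputs_splice, splice_add, Hnode.
          specialize (Hok (S k)). unfold ok in Hok. rewrite forallb_seq_true in Hok.
          specialize (Hok k ltac:(lia)).
          destruct (Nat.eqb_spec (label X b y k) 2) as [E | E]; [auto | right].
          now apply Nat.eqb_eq. }
      * intros k. exists (S m + 3 * S k). rewrite outputs_splice, Hnode.
        pose proof (ok_outputs X b y z (S k) Hok). lia.
    (* The covering string [s] contradicts avoidance at level [length s]. *)
    + apply (proj2 (Hw (length s))). exists s. repeat split; auto. lia.
Qed.
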